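(* Let $D$ be an algebraically closed division ring with infinite center $F$ and let $n$ be a positive integer. Let $p$ be a polynomial in non-commuting variables $x_1,\ldots,x_m$ with coefficients in $F$, where $m$ is a positive integer, such that $p$ has zero constant term and $p(F)\neq\{0\}$. Then every matrix $A\in\mathrm{M}_n(D)$ can be expressed as a sum of two elements of $p(\mathrm{M}_n(D))$, as a product of two elements of $p(\mathrm{M}_n(D))$, and, for any scalars $\lambda,\mu\in F\setminus\{0\}$, as a linear combination $A=\lambda B+\mu C$ with $B,C\in p(\mathrm{M}_n(D))$.
   Context: A polynomial in the central variable $x$ over a division ring $D$ is an expression $a_tx^t+\cdots+a_1x+a_0$ with $a_i\in D$, where $x$ commutes with all elements of $D$; $a\in D$ is a (right) root of it if $a_ta^t+\cdots+a_1a+a_0=0$. A division ring $D$ (commutative or not) is (right) algebraically closed if every nonconstant polynomial in a central variable with coefficients in $D$ has a (right) root in $D$. For an $F$-algebra $R$ and a polynomial $p$ in the free algebra $F\langle x_1,\dots,x_m\rangle$, $p(R)=\{p(r_1,\dots,r_m)\mid r_1,\dots,r_m\in R\}$. $\mathrm{M}_n(D)$ is the ring of $n\times n$ matrices over $D$. *)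

(* Defs.v *)
From HB Require Import structures.
From mathcomp Require Import all_boot all_order all_algebra.
From mathcomp Require Import boolp classical_sets functions cardinality.
From mathcomp Require Import monalg.

Set Implicit Arguments.
Unset Strict Implicit.
Unset Printing Implicit Defensive.

Import GRing.Theory.
Local Open Scope ring_scope.
Local Open Scope classical_set_scope.

Definition division_ring (D : unitRingType) : Prop :=
  forall x : D, x != 0 -> x \is a GRing.unit.

Definition center (R : nzRingType) : set R :=
  [set z | forall x : R, GRing.comm z x].
Arguments center R _ : clear implicits.

(* {poly R} has a central variable, and for noncommutative R the Horner value
   p.[a] is the sum of p`_i * a ^+ i (horner_coef), coefficients on the left;
   hence [root] is the right root. *)
Definition algebraically_closed (R : nzRingType) : Prop :=
  forall p : {poly R}, (1 < size p)%N -> exists a : R, root p a.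

Notation "{ 'freealg' F [ m ] }" := {malg F[{fmonom 'I_m}]}
  (at level 0, F, m at level 2, format "{ 'freealg'  F [ m ] }") : type_scope.

Definition const_coef (F : fieldType) m (p : {freealg F[m]}) : F :=
  p@_(mone : {fmonom 'I_m}).

Definition free_eval (F : fieldType) m (R : algType F) (r : 'I_m -> R)
    (p : {freealg F[m]}) : R :=
  mmap (in_alg R) (fun w : {fmonom 'I_m} => \prod_(i <- w) r i) p.

Definition image_of (F : fieldType) m (p : {freealg F[m]}) (R : algType F) :
    set R :=
  range (fun r : 'I_m -> R => free_eval r p).
Arguments image_of {F m} p R _.

(* Needed because the library gives 'M[D]_n.+1 an algebra structure only over
   its own coefficient ring D, and only for commutative D; the ring structure
   below is the library's, and scalars of F act entrywise. *)
Definition matalg (F : fieldType) (D : algType F) (n : nat) : Type :=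
  'M[D]_n.

Section MatAlg.
Variables (F : fieldType) (D : algType F) (n : nat).

HB.instance Definition _ := GRing.NzRing.on (matalg D n.+1).

Definition mat_scale (c : F) (A : matalg D n.+1) : matalg D n.+1 :=
  map_mx (fun x : D => c *: x) A.

Fact mat_scaleA a b A : mat_scale a (mat_scale b A) = mat_scale (a * b) A.
Proof. by apply/matrixP => i j; rewrite !mxE scalerA. Qed.

Fact mat_scale1 : left_id 1 mat_scale.
Proof. by move=> A; apply/matrixP => i j; rewrite !mxE scale1r. Qed.

Fact mat_scaleDr : right_distributive mat_scale +%R.
Proof. by move=> c A B; apply/matrixP => i j; rewrite !mxE scalerDr. Qed.

Fact mat_scaleDl A : {morph mat_scale^~ A : a b / a + b}.
Proof. by move=> a b; apply/matrixP => i j; rewrite !mxE scalerDl. Qed.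

HB.instance Definition _ := GRing.Zmodule_isLmodule.Build F (matalg D n.+1)
  mat_scaleA mat_scale1 mat_scaleDr mat_scaleDl.

Fact mat_scaleAl (c : F) (A B : matalg D n.+1) : c *: (A * B) = (c *: A) * B.
Proof.
apply/matrixP => i j; rewrite !mxE scaler_sumr.
by apply: eq_bigr => k _; rewrite !mxE scalerAl.
Qed.

HB.instance Definition _ := GRing.Lmodule_isLalgebra.Build F (matalg D n.+1)
  mat_scaleAl.

Fact mat_scaleAr (c : F) (A B : matalg D n.+1) : c *: (A * B) = A * (c *: B).
Proof.
apply/matrixP => i j; rewrite !mxE scaler_sumr.
by apply: eq_bigr => k _; rewrite !mxE scalerAr.
Qed.

HB.instance Definition _ := GRing.Lalgebra_isAlgebra.Build F (matalg D n.+1)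
  mat_scaleAr.

End MatAlg.

(* Main.v *)
(* On a line through the origin where [p] does not vanish identically, [p]
   becomes a nonconstant [q] in F[X]; as [D] is algebraically closed, q(D) = D,
   so every matrix similar to a diagonal one over [D] lies in the image of [p].
   It remains to write any [A] as [l B + m C] and as [B C] with [B], [C] similar
   to diagonal matrices, by induction on the size.  If [A] is not diagonal, a
   conjugation gives its corner any prescribed value [k]: [A ~ (k u; w A')].
   Take [k = 0] for the sum and [k = 1] for the product, decompose [A'], resp.
   [A' - w u], by induction into [B'] and [C'], and set [B = (b 0; * B')],
   [C = (c *; 0 C')] with [b], [c] central.  As [F] is infinite, [b] and [c] can
   be chosen outside the diagonals found for [B'] and [C']; the off-diagonal
   blocks are then removed by solving a Sylvester equation, which is easy
   because [b] and [c] are central. *)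

Require Import Defs.
From mathcomp Require Import all_boot all_order all_algebra.
From mathcomp Require Import boolp classical_sets functions cardinality.
From mathcomp Require Import perm finmap monalg.
Set Implicit Arguments.
Unset Strict Implicit.
Unset Printing Implicit Defensive.

Import GRing.Theory.
Local Open Scope ring_scope.
Local Open Scope classical_set_scope.

(** The diagonal [d] is a parameter because the inductions must pick each new corner entry outside
    it. *)
Definition diag_similar (R : nzRingType) n (d : 'rV[R]_n) (M : 'M[R]_n) : Prop :=
  exists P Q : 'M[R]_n,
    [/\ P *m Q = 1%:M, Q *m P = 1%:M & M = P *m diag_mx d *m Q].

(** * Similarity to a diagonal matrix over an arbitrary ring *)

Section DiagSimilar.
Variable R : nzRingType.

Lemma diag_similar_diag n (d : 'rV[R]_n) : diag_similar d (diag_mx d).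
Proof. by exists 1%:M, 1%:M; rewrite !mul1mx mulmx1. Qed.

Lemma diag_similar_conj n (d : 'rV[R]_n) (M U V : 'M[R]_n) :
  U *m V = 1%:M -> V *m U = 1%:M ->
  diag_similar d M -> diag_similar d (U *m M *m V).
Proof.
move=> UV VU [P [Q [PQ QP ->]]]; exists (U *m P), (Q *m V); split.
- by rewrite mulmxA -(mulmxA U) PQ mulmx1.
- by rewrite mulmxA -(mulmxA Q) VU mulmx1.
- by rewrite !mulmxA.
Qed.

Lemma scalemx_center_mulmx m n q (k : R) (A : 'M[R]_(m, n)) (B : 'M[R]_(n, q)) :
  center R k -> A *m (k *: B) = k *: (A *m B).
Proof.
move=> kC; apply/matrixP => i j; rewrite !mxE mulr_sumr.
by apply: eq_bigr => l _; rewrite !mxE mulrA -kC -mulrA.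
Qed.

End DiagSimilar.

(** * Decompositions of matrices over a division ring *)

Section DivisionRing.
Variable R : unitRingType.
Hypothesis R_div : division_ring R.

(** A block unipotent conjugation removes [x] once a Sylvester equation is solved. In the basis
    where [B] is diagonal, and with [k] central, it splits into the scalar equations
    [(k - d_i) v_i = (Q x)_i]. *)
Lemma diag_similar_block_lower n (k : R) (d : 'rV[R]_n) (B : 'M[R]_n)
    (x : 'cV[R]_n) :
  center R k -> (forall i, d 0 i != k) -> diag_similar d B ->
  diag_similar (row_mx k%:M d) (block_mx k%:M 0 x B).
Proof.
move=> kC dNk [P [Q [PQ QP ->]]].
pose v : 'cV[R]_n := \col_i ((k - d 0 i)^-1 * (Q *m x) i 0).
have vE : v *m k%:M - diag_mx d *m v = Q *m x.
  apply/colP => i; rewrite -diag_const_mx mul_mx_diag mul_diag_mx !mxE -kC -mulrBl.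
  by rewrite mulrA mulrV ?mul1r //; apply: R_div; rewrite subr_eq0 eq_sym.
exists (block_mx 1%:M 0 (P *m v) P), (block_mx 1%:M 0 (- v) Q); split.
- by rewrite mulmx_block !(mul1mx, mulmx1, mul0mx, mulmx0, addr0, add0r) PQ
    mulmxN subrr -scalar_mx_block.
- by rewrite mulmx_block !(mul1mx, mulmx1, mul0mx, mulmx0, addr0, add0r) mulmxA
    QP mul1mx addNr -scalar_mx_block.
- rewrite diag_mx_row !mulmx_block !(mul1mx, mulmx1, mul0mx, mulmx0, addr0, add0r).
  rewrite mulmxN -!mulmxA -mulmxBr.
  have -> : diag_mx (k%:M : 'M_1) = k%:M :> 'M[R]_1.
    by apply/matrixP=> i j; rewrite !mxE !ord1.
  by rewrite vE !mulmxA PQ mul1mx.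
Qed.

(** Mirror case: the equations become [v_i (k - d_i) = (y P)_i], so the inverses multiply on the
    right. *)
Lemma diag_similar_block_upper n (k : R) (d : 'rV[R]_n) (B : 'M[R]_n)
    (y : 'rV[R]_n) :
  center R k -> (forall i, d 0 i != k) -> diag_similar d B ->
  diag_similar (row_mx k%:M d) (block_mx k%:M y 0 B).
Proof.
move=> kC dNk [P [Q [PQ QP ->]]].
pose v : 'rV[R]_n := \row_i ((y *m P) 0 i * (k - d 0 i)^-1).
have vE : k%:M *m v - v *m diag_mx d = y *m P.
  apply/rowP => i; rewrite mul_scalar_mx mul_mx_diag !mxE kC -mulrBr -mulrA.
  by rewrite mulVr ?mulr1 //; apply: R_div; rewrite subr_eq0 eq_sym.
exists (block_mx 1%:M (- v) 0 P), (block_mx 1%:M (v *m Q) 0 Q); split.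
- by rewrite mulmx_block !(mul1mx, mulmx1, mul0mx, mulmx0, addr0, add0r) PQ
    mulNmx subrr -scalar_mx_block.
- by rewrite mulmx_block !(mul1mx, mulmx1, mul0mx, mulmx0, addr0, add0r) -mulmxA
    QP mulmx1 addNr -scalar_mx_block.
- rewrite diag_mx_row !mulmx_block !(mul1mx, mulmx1, mul0mx, mulmx0, addr0, add0r).
  have -> : diag_mx (k%:M : 'M_1) = k%:M :> 'M[R]_1.
    by apply/matrixP=> i j; rewrite !mxE !ord1.
  by rewrite !mulNmx mulmxA -mulmxBl vE -(mulmxA y) PQ mulmx1.
Qed.

(** A transposition moves a nonzero off-diagonal entry into the first column, below the corner; a
    shear then adjusts the corner at will. *)
Lemma nondiag_similar_block n (A : 'M[R]_(1 + n)) (k : R) :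
  ~~ is_diag_mx A ->
  exists (U V : 'M[R]_(1 + n)) u w A',
    [/\ U *m V = 1%:M, V *m U = 1%:M
      & A = U *m block_mx k%:M u w A' *m V].
Proof.
case/forallPn => j /forallPn [i]; rewrite negb_imply => /andP[ji Aji].
pose s := tperm (lshift n ord0 : 'I_(1 + n)) i.
pose B := perm_mx s *m A *m perm_mx s.
have ss : perm_mx s *m perm_mx s = 1%:M :> 'M[R]_(1 + n).
  by rewrite -perm_mxM tperm2 perm_mx1.
have AE : A = perm_mx s *m B *m perm_mx s.
  by rewrite /B !mulmxA ss mul1mx -mulmxA ss mulmx1.
have BE a b : B a b = A (s a) (s b).
  have sV : s = (s^-1)%g by rewrite tpermV.
  by rewrite /B -row_permE {2}sV -col_permE !mxE.
move: B AE BE => B AE BE.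
have [l lE] : exists l, dlsubmx B l 0 != 0.
  have sj0 : s j != lshift n ord0.
    apply/eqP => sj; have := tpermK (lshift n ord0 : 'I_(1 + n)) i j.
    by rewrite -/s sj tpermL => ij; rewrite ij eqxx in ji.
  case: (split_ordP (s j)) sj0 => [a -> | l sjl _]; first by rewrite ord1 eqxx.
  by exists l; rewrite !mxE BE -sjl tpermK tpermL.
pose w := dlsubmx B.
(* Supported at the index [l] where [w] is invertible, and scaled so that [r *m w] is the excess of
   the corner over [k]. *)
pose r : 'rV[R]_n := ((B 0 0 - k) * (w l 0)^-1) *: delta_mx 0 l.
have rw : r *m w = (B 0 0 - k)%:M.
  apply/matrixP => a b; rewrite !ord1 -scalemxAl -rowE !mxE eqxx mulr1n.
  by rewrite -mulrA; have := mulVr (R_div lE); rewrite !mxE => ->; rewrite mulr1.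
pose N := block_mx 1%:M r 0 1%:M : 'M[R]_(1 + n).
pose N' := block_mx 1%:M (- r) 0 1%:M : 'M[R]_(1 + n).
have NN' : N *m N' = 1%:M.
  by rewrite mulmx_block !(mul1mx, mulmx1, mul0mx, mulmx0, addr0, add0r) addNr
    -scalar_mx_block.
have N'N : N' *m N = 1%:M.
  by rewrite mulmx_block !(mul1mx, mulmx1, mul0mx, mulmx0, addr0, add0r) subrr
    -scalar_mx_block.
have [u [A' NB]] : exists u A', N' *m B *m N = block_mx k%:M u w A'.
  rewrite -{1}(submxK B) /N /N'.
  rewrite !mulmx_block !(mul1mx, mulmx1, mul0mx, mulmx0, addr0, add0r).
  rewrite mulNmx rw.
  have -> : ulsubmx B = (B 0 0)%:M.
    apply/matrixP => a b; rewrite !ord1 !mxE eqxx mulr1n.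
    by congr (B _ _); apply: val_inj.
  by rewrite -raddfB /= subKr; do 2!eexists.
exists (perm_mx s *m N), (N' *m perm_mx s), u, w, A'; split.
- by rewrite mulmxA -(mulmxA _ N) NN' mulmx1.
- by rewrite mulmxA -(mulmxA N') ss mulmx1.
- by rewrite -NB AE !mulmxA -(mulmxA _ N N') NN' mulmx1
    -(mulmxA _ N N') NN' mulmx1.
Qed.

Hypothesis R_center : infinite_set (center R).

(** The forbidden [k] form a finite set, as [f] is injective. In use, [f] sends the corner of one
    factor or summand to that of the other, so one choice serves both. *)
Lemma center_avoid (f : R -> R) (s t : seq R) :
  injective f -> exists k, [/\ center R k, k \notin s & f k \notin t].
Proof.
move=> f_inj; apply: contrapT => no_k; apply: R_center.
apply: (@sub_finite_set _ _ ([set` s] `|` f @^-1` [set` t])) => [k kC|].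
  apply: contrapT => /= /not_orP [/negP ks /negP kt].
  by apply: no_k; exists k.
rewrite finite_setU; split=> //; apply: finite_preimage => //.
by move=> x y _ _; apply: f_inj.
Qed.

Lemma notin_codom_neq n (d : 'rV[R]_n) (k : R) :
  k \notin codom (d 0) -> forall i, d 0 i != k.
Proof. by move=> kd i; apply: contraNneq kd => <-; apply: codom_f. Qed.

Lemma lincomb_diag_similar n (A : 'M[R]_n) (l m : R) :
  center R l -> center R m -> l != 0 -> m != 0 ->
  exists d e B C,
    [/\ diag_similar d B, diag_similar e C & A = l *: B + m *: C].
Proof.
move=> lC mC /R_div lU /R_div mU.
elim: n A => [|n IHn] A.
  exists 0, 0, (diag_mx 0), (diag_mx 0).
  by split; try exact: diag_similar_diag; rewrite [A]flatmx0 [RHS]flatmx0.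
have [/diag_mxP [a ->]|Adiag] := boolP (is_diag_mx A).
  exists (l^-1 *: a), 0, (diag_mx (l^-1 *: a)), (diag_mx 0).
  split; try exact: diag_similar_diag.
  apply/matrixP => i j; rewrite !mxE mul0rn mulr0 addr0.
  by rewrite -mulrnAr mulVKr.
have [U [V [u [w [A' [UV VU ->]]]]]] :=
  @nondiag_similar_block n (A : 'M_(1 + n)) 0 Adiag.
have [d [e [B [C [dB eC ->]]]]] := IHn A'.
(* The zero corner requires [l * b + m * c = 0], which determines [c] from [b]. *)
have f_inj : injective (fun k => - (m^-1 * (l * k))).
  move=> x y /oppr_inj /(mulrI _) mm; apply: (mulrI lU); apply: mm.
  by rewrite unitrV.
have [b [bC /notin_codom_neq db /notin_codom_neq ec]] :=
  center_avoid (codom (d 0)) (codom (e 0)) f_inj.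
set c := - _ in ec.
have cC : center R c.
  move=> x; apply/commr_sym/commrN/commrM; first exact/commrV/commr_sym/mC.
  by apply: commrM; apply/commr_sym; [apply: lC | apply: bC].
(* All of [w] goes to one summand and all of [u] to the other, so both are block triangular. *)
pose B1 := block_mx b%:M 0 (l^-1 *: w) B; pose C1 := block_mx c%:M (m^-1 *: u) 0 C.
exists (row_mx b%:M d), (row_mx c%:M e), (U *m B1 *m V), (U *m C1 *m V); split.
- by apply: diag_similar_conj => //; apply: diag_similar_block_lower.
- by apply: diag_similar_conj => //; apply: diag_similar_block_upper.
have scale_conj k X : center R k -> k *: (U *m X *m V) = U *m (k *: X) *m V.
  by move=> kC; rewrite scalemx_center_mulmx // -scalemxAl.
rewrite !scale_conj // -mulmxDl -mulmxDr.
congr (_ *m _ *m _).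
rewrite !scale_block_mx add_block_mx !scaler0 add0r addr0 !scalerA !divrr //.
by rewrite !scale1r !scale_scalar_mx -raddfD /= /c mulrN mulVKr // subrr.
Qed.

Lemma prod_diag_similar n (A : 'M[R]_n) :
  exists d e B C, [/\ diag_similar d B, diag_similar e C & A = B *m C].
Proof.
elim: n A => [|n IHn] A.
  exists 0, 0, (diag_mx 0), (diag_mx 0).
  by split; try exact: diag_similar_diag; rewrite [A]flatmx0 [RHS]flatmx0.
have [/diag_mxP [a ->]|Adiag] := boolP (is_diag_mx A).
  exists a, (const_mx 1), (diag_mx a), (diag_mx (const_mx 1)).
  by split; try exact: diag_similar_diag; rewrite diag_const_mx mulmx1.
have [U [V [u [w [A' [UV VU ->]]]]]] :=
  @nondiag_similar_block n (A : 'M_(1 + n)) 1 Adiag.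
(* With corners [b] and [b^-1], the off-diagonal blocks contribute [w *m u] to the lower right block
   of the product; the induction handles the rest. *)
have [d [e [B [C [dB eC BC]]]]] := IHn (A' - w *m u).
(* Adding [0] to the avoided values makes [b] invertible. *)
have [b [bC + /notin_codom_neq ec]] :=
  center_avoid (0 :: codom (d 0)) (codom (e 0)) (@invr_inj R).
rewrite inE negb_or => /andP [/R_div bU /notin_codom_neq db].
have cC : center R b^-1 by move=> x; apply/commr_sym/commrV/commr_sym/bC.
pose B1 := block_mx b%:M 0 (b *: w) B.
pose C1 := block_mx b^-1%:M (b^-1 *: u) 0 C.
exists (row_mx b%:M d), (row_mx b^-1%:M e), (U *m B1 *m V), (U *m C1 *m V); split.
- by apply: diag_similar_conj => //; apply: diag_similar_block_lower.
- by apply: diag_similar_conj => //; apply: diag_similar_block_upper.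
rewrite !mulmxA -(mulmxA _ V U) VU mulmx1 -(mulmxA U B1); congr (_ *m _ *m _).
rewrite mulmx_block !(mul0mx, mulmx0, addr0) -BC -scalar_mxM divrr //.
have -> : b^-1%:M = b^-1 *: 1%:M :> 'M[R]_1 by rewrite scale_scalar_mx mulr1.
rewrite -!scalemxAl !scalemx_center_mulmx // mul_scalar_mx !scalerA.
by rewrite ?mulrV ?mulVr // !scale1r mulmx1 addrC subrK.
Qed.

End DivisionRing.

(** * Values of [p] on algebras and on diagonalizable matrices *)

Section Image.
Variable F : fieldType.

Lemma free_eval_rmorph (R S : algType F) (f : {rmorphism R -> S}) m
    (r : 'I_m -> R) (p : {freealg F[m]}) :
  (forall c : F, f c%:A = c%:A) -> f (free_eval r p) = free_eval (f \o r) p.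
Proof.
move=> fA; rewrite /free_eval !mmapE rmorph_sum; apply: eq_bigr => w _.
by rewrite rmorphM rmorph_prod /= fA.
Qed.

(** Every nonempty word acquires a zero factor, so only the empty word survives. *)
Lemma free_eval0 (R : algType F) m (p : {freealg F[m]}) :
  free_eval (fun _ => 0 : R) p = (const_coef p)%:A.
Proof.
have prod0 (w : {fmonom 'I_m}) :
    \prod_(i <- w) (0 : R) = if w == mone then 1 else 0.
  case: eqP => [->|w1]; first by rewrite fm1 big_nil.
  case: w w1 => [[|i s] w1]; last by rewrite big_cons mul0r.
  by case: w1; apply: val_inj; rewrite /= fm1.
rewrite /free_eval mmapE /const_coef.
have [w1|w1] := boolP (mone \in msupp p); last first.
  rewrite (mcoeff_outdom w1) scale0r big_seq big1 // => w wp.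
  by rewrite prod0 ifN ?mulr0 //; apply: contraNneq w1 => <-.
rewrite (big_fsetD1 _ w1) /= prod0 eqxx mulr1 big_seq big1 ?addr0 // => w.
by rewrite in_fsetD1 => /andP [/negbTE wn1 _]; rewrite prod0 wn1 mulr0.
Qed.

(** Here [q] is [p] evaluated at the polynomials [a i *: 'X], for a point [a] with [p(a)] nonzero:
    [q(0) = 0] and [q(1) = p(a)], so [q] is not constant. *)
Lemma image_of_horner m (p : {freealg F[m]}) :
  const_coef p = 0 -> image_of p F^o <> [set 0] ->
  exists q : {poly F}, (1 < size q)%N /\
    forall (R : algType F) (x : R), image_of p R (horner_alg x q).
Proof.
move=> p0 pF.
have eval0 : free_eval (fun=> 0 : F^o) p = 0 by rewrite free_eval0 p0 scale0r.
have [a pa] : exists a : 'I_m -> F^o, free_eval a p != 0.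
  apply: contrapT => no_a; apply: pF; apply/seteqP; split=> x /=.
    by move=> [a _ <-]; apply: contrapT => /eqP pa; apply: no_a; exists a.
  by move=> ->; exists (fun=> 0).
pose q : {poly F} := free_eval (fun i => a i *: 'X) p.
have qE (R : algType F) (x : R) :
    horner_alg x q = free_eval (fun i => a i *: x) p.
  rewrite /q (@free_eval_rmorph _ _ (horner_alg x)) => [|c]; last first.
    by rewrite alg_polyC; apply: horner_algC.
  congr (free_eval _ p); apply/funext => i /=.
  by rewrite -mul_polyC rmorphM /= horner_algC horner_algX mulr_algl.
exists q; split; last by move=> R x; rewrite qE; exists (fun i => a i *: x).
rewrite ltnNge; apply/negP => /size1_polyC q_const.
have q0 : (q`_0)%:A = 0 :> F^o.
  rewrite -(horner_algC (0 : F^o)) -q_const qE.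
  rewrite -[RHS]eval0; congr (free_eval _ p).
  by apply/funext => i; rewrite scaler0.
case/negP: pa; apply/eqP; rewrite -[RHS]q0 -(horner_algC (1 : F^o)) -q_const qE.
by congr (free_eval _ p); apply/funext => i; rewrite [RHS]mulr1.
Qed.

Variable D : algType F.

(** A preimage of [d] is a root of [q - d], whose size is still that of [q]. *)
Lemma horner_alg_surj (q : {poly F}) (d : D) :
  algebraically_closed D -> (1 < size q)%N -> exists x : D, horner_alg x q = d.
Proof.
move=> D_closed q_size.
have [|x] := D_closed (map_poly (in_alg D) q - d%:P).
  by rewrite size_polyDl size_map_poly // size_polyN (leq_ltn_trans (size_polyC_leq1 _)).
by rewrite /root hornerD hornerN hornerC subr_eq0 => /eqP <-; exists x.
Qed.

(** The coefficients of [q] are central, so evaluation commutes with conjugation and acts entrywise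
    on a diagonal. *)
Lemma horner_alg_diag_similar n (q : {poly F}) (P Q : matalg D n.+1)
    (x : 'rV[D]_n.+1) :
  P *m Q = 1%:M -> Q *m P = 1%:M ->
  horner_alg (P *m diag_mx x *m Q : matalg D n.+1) q
    = P *m diag_mx (\row_i horner_alg (x 0 i) q) *m Q.
Proof.
move=> PQ QP; set M : matalg D n.+1 := P *m _ *m Q.
elim/poly_ind: q => [|q c IHq].
  by rewrite rmorph0 (_ : \row_i _ = 0) ?raddf0 ?mulmx0 ?mul0mx //;
    apply/rowP => i; rewrite !mxE rmorph0.
rewrite rmorphD rmorphM /= horner_algX horner_algC IHq.
(* A central scalar matrix is fixed by conjugation. *)
have -> : c%:A = P *m diag_mx (const_mx c%:A) *m Q :> matalg D n.+1.
  have cC : center D c%:A by move=> y; apply: comm_alg.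
  rewrite diag_const_mx -scalemx1 scalemx_center_mulmx // mulmx1 -scalemxAl PQ.
  by apply/matrixP => i j; rewrite !mxE mulr_algl.
rewrite [X in X + _](_ : _ = P *m diag_mx (\row_i (horner_alg (x 0 i) q * x 0 i)) *m Q).
  rewrite -mulmxDl -mulmxDr -raddfD; congr (_ *m diag_mx _ *m _).
  by apply/rowP => i; rewrite !mxE rmorphD rmorphM /= horner_algX horner_algC.
have conjM (X Y : 'M[D]_n.+1) :
    (P *m X *m Q) *m (P *m Y *m Q) = P *m (X *m Y) *m Q.
  by rewrite !mulmxA -(mulmxA _ Q P) QP mulmx1.
apply: etrans (conjM _ _) _; rewrite mulmx_diag.
by congr (_ *m diag_mx _ *m _); apply/rowP => i; rewrite !mxE.
Qed.

Lemma image_of_diag_similar m (p : {freealg F[m]}) n (d : 'rV[D]_n.+1)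
    (A : matalg D n.+1) :
  algebraically_closed D -> const_coef p = 0 -> image_of p F^o <> [set 0] ->
  diag_similar d A -> image_of p (matalg D n.+1) A.
Proof.
move=> D_closed p0 pF [P [Q [PQ QP ->]]].
have [q [q_size q_im]] := image_of_horner p0 pF.
(* The diagonal entries are lifted through [q] one by one. *)
have [x xd] := choice (fun i => horner_alg_surj (d 0 i) D_closed q_size).
have <- : horner_alg (P *m diag_mx (\row_i x i) *m Q : matalg D n.+1) q
    = P *m diag_mx d *m Q; last exact: q_im.
rewrite horner_alg_diag_similar //; congr (_ *m diag_mx _ *m _).
by apply/rowP => i; rewrite !mxE.
Qed.

End Image.

Theorem theorem4p7 (F : fieldType) (D : unitAlgType F)
    (hD : division_ring D)
    (hF : center D = range (in_alg D))
    (hinf : infinite_set [set: F])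
    (hclosed : algebraically_closed D)
    (n m : nat) (hm : (0 < m)%N)
    (p : {freealg F[m]})
    (hp0 : const_coef p = 0)
    (hpF : image_of p F^o <> [set 0])
    (A : matalg D n.+1) :
  (exists B C : matalg D n.+1,
      [/\ image_of p (matalg D n.+1) B, image_of p (matalg D n.+1) C & A = B + C])
  /\ (exists B C : matalg D n.+1,
      [/\ image_of p (matalg D n.+1) B, image_of p (matalg D n.+1) C & A = B * C])
  /\ (forall lambda mu : F, lambda != 0 -> mu != 0 ->
      exists B C : matalg D n.+1,
      [/\ image_of p (matalg D n.+1) B, image_of p (matalg D n.+1) C
        & A = lambda *: B + mu *: C]).
Proof.
have center_alg (c : F) : center D c%:A by move=> x; apply: comm_alg.
have D_center : infinite_set (center D).
  move=> center_fin; apply: hinf.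
  apply: sub_finite_set (finite_preimage _ center_fin) => [c _|].
    exact: center_alg c.
  by move=> x y _ _; apply: (fmorph_inj (in_alg D)).
have image_diag d B : diag_similar d B -> image_of p (matalg D n.+1) B.
  exact: image_of_diag_similar.
have lincomb (l m' : F) : l != 0 -> m' != 0 -> exists B C : matalg D n.+1,
    [/\ image_of p (matalg D n.+1) B, image_of p (matalg D n.+1) C
      & A = l *: B + m' *: C].
  move=> l0 m0.
  have alg0 (c : F) : c != 0 -> c%:A != 0 :> D by rewrite scaler_eq0 oner_eq0 orbF.
  have [d [e [B [C [dB eC ->]]]]] := lincomb_diag_similar hD D_center A
    (center_alg l) (center_alg m') (alg0 l l0) (alg0 m' m0).
  exists B, C; split; [exact: image_diag dB | exact: image_diag eC |].
  (* The entrywise action of a scalar of [F] is left multiplication by its image in [D]. *)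
  by apply/matrixP => i j; rewrite !mxE !mulr_algl.
split; last split=> //.
  have [B [C [Bp Cp ->]]] := lincomb 1 1 (oner_neq0 _) (oner_neq0 _).
  by exists B, C; rewrite !scale1r.
have [d [e [B [C [dB eC ->]]]]] := prod_diag_similar hD D_center A.
by exists B, C; split; [exact: image_diag dB | exact: image_diag eC |].
Qed.
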